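(* Assume the baseline output function $T$ is strictly convex. For $p\in[0,1]$ let $A_{\mathrm{qu}}(p)$ be the game payoff achieved by a quantum strategy of splitting probability $p$, and let $A^*_{\mathrm{cl,SR}}(p)$ be the optimal payoff of classical strategies with shared randomness of splitting probability $p$. Let $\mathcal{P}=\{p\in[0,1]: A_{\mathrm{qu}}(p)>A^*_{\mathrm{cl,SR}}(p)\}$. Then quantum strategies Pareto-dominate classical strategies over $\mathcal{P}$: for all $p\in\mathcal{P}$, $$\Delta W_q^{\mathrm{qu}}(p)<\Delta W_q^{\mathrm{cl}}(p)$$ at identical baseline throughput $\mathcal{T}(p)$.
   Context: Queueing model. Fix $\lambda,\mu>0$ with $\rho=\lambda/\mu<1$. There are two identical first-come-first-served servers with unlimited queues. Customers arrive in pairs according to a Poisson process of rate $\lambda$; the service times $X_1,X_2$ of a pair are i.i.d. $\mathrm{Exp}(\mu)$, independent across pairs. If a pair with service times $(x_1,x_2)$ is split (one customer to each server) with probability $r(x_1,x_2)$ and otherwise bunched (both to the same server), the splitting probability is $p=\mathbb{E}[r(X_1,X_2)]$. Server assignment is load-balanced: when splitting, each server is equally likely to receive either customer; when bunching, the destination server is uniformly random, and a uniformly random one of the two customers goes first. Each server is then an $M^X/G/1$ queue with batch arrival rate $\Lambda=\lambda(1+p)/2$, utilization $\rho$, and batch workload $B_s$ satisfying $\Lambda\mathbb{E}[B_s^2]=\frac{\lambda}{2}\mathbb{E}[(1-r)(X_1+X_2)^2+r(X_1^2+X_2^2)]$, and the mean customer waiting time is the Pollaczek--Khinchine mean virtual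 wait plus the mean within-batch delay: $\mathbb{E}[W_q]=\frac{\Lambda\mathbb{E}[B_s^2]}{2(1-\rho)}+\frac14\mathbb{E}[(1-r)(X_1+X_2)]$. Baseline throughput. A server with no customers works on a baseline task; $T(t)$ is the output of an uninterrupted period of length $t$, where $T$ is differentiable, increasing, $T(0)=0$. The long-run average baseline throughput per server is $\mathcal{T}(p)=\mathbb{E}[T(I)]/\mathbb{E}[I+B]$, where $I\sim\mathrm{Exp}(\Lambda)$ and $\mathbb{E}[B]=\rho/(\Lambda(1-\rho))$. Strategies. Router A observes only $X_1$ and outputs $o_A\in\{\pm1\}$; router B observes only $X_2$ and outputs $o_B\in\{\pm1\}$; no communication. The pair is split iff $o_Ao_B=-1$. The splitting probability is $p=\Pr[o_Ao_B=-1]$ and the game payoff is $A=-\mathbb{E}[o_Ao_B\,w(X_1,X_2)]$, with $w(x_1,x_2)=c_1x_1x_2+c_2(x_1+x_2)$, $c_1=\frac{\lambda}{2(1-\rho)}$, $c_2=\frac14$. A deterministic classical strategy is a pair of measurable functions $o_A,o_B:\mathbb{R}_+\to\{\pm1\}$. A classical strategy with shared randomness uses a common random variable $\kappa$, independent of $(X_1,X_2)$, to select a deterministic strategy $(o_{A,\kappa},o_{B,\kappa})$; its splitting probability and payoff are averages over $\kappa$, and $A^*_{\mathrm{cl,SR}}(p)$ is the supremum of payoffs over such strategies with mean splitting probability $p$. In a quantum strategy the routers share a bipartite entangled state and each obtains its output by a local $\pm1$-valued measurement chosen according to its local input. All strategies employ load-balanced server assignment. The $w$-threshold policy at $p$ (using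 both service times) splits iff $w(X_1,X_2)>\tau_p$ with $\Pr[w(X_1,X_2)>\tau_p]=p$. $\Delta W_q^{\mathrm{qu}}(p)$ is the mean waiting time of the quantum strategy achieving payoff $A_{\mathrm{qu}}(p)$ minus that of the $w$-threshold policy at $p$; $\Delta W_q^{\mathrm{cl}}(p)$ is the optimal (infimal) value of the same difference over classical strategies with shared randomness of splitting probability $p$. *)

(* Defs.v *)
From HB Require Import structures.
From mathcomp Require Import all_boot all_order all_algebra.
From mathcomp Require Import complex.
From mathcomp Require Import all_classical all_reals all_analysis.

Set Implicit Arguments.
Unset Strict Implicit.
Unset Printing Implicit Defensive.

Import Order.TTheory GRing.Theory Num.Theory.
Import numFieldNormedType.Exports.

Local Open Scope classical_set_scope.
Local Open Scope ring_scope.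

Section BaselineOutput.
Context {R : realType}.
Implicit Type T : R -> R.

(* [T] is a function on the half line [0, +oo); its values on negative
   arguments are irrelevant, and differentiability at 0 is one-sided. *)
Definition differentiable_halfline T : Prop :=
  (forall t : R, 0 < t -> derivable T t 1) /\
  cvg ((fun h : R => h^-1 * (T h - T 0)) @ 0^'+).

Definition increasing_halfline T : Prop :=
  forall s t : R, 0 <= s -> s < t -> T s < T t.

Definition strictly_convex_halfline T : Prop :=
  forall s t a : R, 0 <= s -> 0 <= t -> s != t -> 0 < a -> a < 1 ->
    T (a * s + (1 - a) * t) < a * T s + (1 - a) * T t.

End BaselineOutput.

(* The two outputs +1 and -1 of a router are labelled by [true] and [false]. *)
Definition outcome (R : realType) (b : bool) : R := if b then 1 else - 1.
Arguments outcome R b : clear implicits.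

(* The routers split iff the product of their outputs is -1. *)
Definition splits (R : realType) (a b : bool) : bool :=
  outcome R a * outcome R b == - 1.
Arguments splits R a b : clear implicits.

Section HilbertSpaces.
Variable R : realType.

Record hilbert := Hilbert {
  hilbert_sort :> lmodType R[i];
  inner : {dot hilbert_sort for (@Num.conj R[i])};
  hilbert_complete : forall u : nat -> hilbert_sort,
    (forall e : R, 0 < e -> exists N : nat, forall m n : nat,
       (N <= m)%N -> (N <= n)%N ->
       complex.Re (inner (u m - u n) (u m - u n)) < e) ->
    exists l : hilbert_sort, forall e : R, 0 < e ->
      exists N : nat, forall n : nat, (N <= n)%N ->
        complex.Re (inner (u n - l) (u n - l)) < e }.
Arguments inner {h}.

Definition sqnorm (H : hilbert) (u : H) : R := complex.Re (inner u u).

(* The Hilbert tensor product of [HA] and [HB], characterised up to unitary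
   equivalence: a Hilbert space spanned, up to closure, by product vectors. *)
Record hilbert_tensor (HA HB : hilbert) := HilbertTensor {
  tensor_sort :> hilbert;
  tens : {bilinear HA -> HB -> tensor_sort};
  inner_tens : forall (a a' : HA) (b b' : HB),
    inner (tens a b) (tens a' b') = inner a a' * inner b b';
  tens_total : forall (psi : tensor_sort) (e : R), 0 < e ->
    exists s : seq (HA * HB),
      sqnorm (psi - \sum_(ab <- s) tens ab.1 ab.2) < e }.

(* Two-outcome generalised measurement (POVM); projective measurements are a
   special case. *)
Record measurement (H : hilbert) := Measurement {
  effect : bool -> {linear H -> H};
  effect_ge0 : forall (o : bool) (u : H), 0 <= inner (effect o u) u;
  effect_sum : forall u : H, effect true u + effect false u = u }.

(* [E] is the operator [P (x) Q] of the tensor product.  It is determined by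
   its values on product vectors together with boundedness; for effects [P]
   and [Q] its norm is at most 1. *)
Definition is_tensor_operator (HA HB : hilbert) (H : hilbert_tensor HA HB)
    (P : {linear HA -> HA}) (Q : {linear HB -> HB})
    (E : {linear H -> H}) : Prop :=
  (forall (a : HA) (b : HB), E (tens H a b) = tens H (P a) (Q b)) /\
  (forall psi : H, sqnorm (E psi) <= sqnorm psi).

(* The shared state is the density operator
     sum_k qs_weight k |qs_vector k><qs_vector k| . *)
Record quantum_strategy := QuantumStrategy {
  qs_HA : hilbert;
  qs_HB : hilbert;
  qs_H : hilbert_tensor qs_HA qs_HB;
  qs_weight : nat -> R;
  qs_vector : nat -> qs_H;
  qs_weight_ge0 : forall k : nat, 0 <= qs_weight k;
  qs_weight_sum : series qs_weight @ \oo --> (1 : R);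
  qs_vector_unit : forall k : nat, sqnorm (qs_vector k) = 1;
  qs_MA : R -> measurement qs_HA;
  qs_MB : R -> measurement qs_HB;
  qs_MA_measurable : forall (o : bool) (u v : qs_HA),
    measurable_fun [set: R]
      (fun x : R => complex.Re (inner (effect (qs_MA x) o u) v));
  qs_MB_measurable : forall (o : bool) (u v : qs_HB),
    measurable_fun [set: R]
      (fun x : R => complex.Re (inner (effect (qs_MB x) o u) v));
  qs_joint : R -> R -> bool -> bool -> {linear qs_H -> qs_H};
  qs_jointE : forall (x1 x2 : R) (a b : bool),
    is_tensor_operator (effect (qs_MA x1) a) (effect (qs_MB x2) b)
      (qs_joint x1 x2 a b) }.

(* Born rule: conditional probability of outputs (a, b) on inputs (x1, x2). *)
Definition qs_prob (q : quantum_strategy) (x1 x2 : R) (a b : bool) : R :=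
  limn (series (fun k : nat => qs_weight q k *
    complex.Re (inner (qs_joint q x1 x2 a b (qs_vector q k))
                      (qs_vector q k)))).

Definition qs_splitting (q : quantum_strategy) (x1 x2 : R) : R :=
  \sum_(a : bool) \sum_(b : bool | splits R a b) qs_prob q x1 x2 a b.

Definition qs_correlation (q : quantum_strategy) (x1 x2 : R) : R :=
  \sum_(a : bool) \sum_(b : bool)
    outcome R a * outcome R b * qs_prob q x1 x2 a b.

(* The probability space of [kappa] is separate from the one carrying the
   service times: [kappa] is independent of them, and averages over [kappa] are
   taken with [sr_law].  Inputs are nonnegative almost surely, so the values of
   the output functions on negative inputs are irrelevant. *)
Record sr_strategy := SrStrategy {
  sr_disp : measure_display;
  sr_space : measurableType sr_disp;
  sr_law : probability sr_space R;
  sr_oA : sr_space -> R -> bool;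
  sr_oB : sr_space -> R -> bool;
  sr_oA_measurable : measurable_fun [set: sr_space * R]
    (fun z : sr_space * R => sr_oA z.1 z.2);
  sr_oB_measurable : measurable_fun [set: sr_space * R]
    (fun z : sr_space * R => sr_oB z.1 z.2) }.
Arguments sr_oA s k x : clear implicits.
Arguments sr_oB s k x : clear implicits.

Definition sr_splitting (s : sr_strategy) (x1 x2 : R) : R :=
  \int[sr_law s]_k (splits R (sr_oA s k x1) (sr_oB s k x2))%:R.

End HilbertSpaces.

Arguments sr_oA {R} s k x.
Arguments sr_oB {R} s k x.

Section Queue.
Context {d : measure_display} {Omega : measurableType d} {R : realType}.
Variables (P : probability Omega R) (X1 X2 : {RV P >-> R}) (lambda mu : R).

Definition iid_exponential : Prop :=
  [/\ forall A : set R, measurable A ->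
        distribution P X1 A = exponential_prob mu A,
      forall A : set R, measurable A ->
        distribution P X2 A = exponential_prob mu A
    & forall A B : set R, measurable A -> measurable B ->
        P (X1 @^-1` A `&` X2 @^-1` B) = (P (X1 @^-1` A) * P (X2 @^-1` B))%E].

Definition rho : R := lambda / mu.

Definition mean (f : R -> R -> R) : R := \int[P]_w f (X1 w) (X2 w).

Definition batch_rate (p : R) : R := lambda * (1 + p) / 2.

(* [batch_rate] times the second moment of the batch workload, for the policy
   that splits with probability [r x1 x2]. *)
Definition batch_rate_second_moment (r : R -> R -> R) : R :=
  lambda / 2 * mean (fun x1 x2 =>
    (1 - r x1 x2) * (x1 + x2) ^+ 2 + r x1 x2 * (x1 ^+ 2 + x2 ^+ 2)).

(* Pollaczek-Khinchine mean virtual wait plus mean within-batch delay. *)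
Definition mean_wait (r : R -> R -> R) : R :=
  batch_rate_second_moment r / (2 * (1 - rho)) +
  4^-1 * mean (fun x1 x2 => (1 - r x1 x2) * (x1 + x2)).

Definition game_weight (x1 x2 : R) : R :=
  lambda / (2 * (1 - rho)) * (x1 * x2) + 4^-1 * (x1 + x2).

(* The mean output of an idle period may be +oo, hence the extended reals. *)
Definition throughput (T : R -> R) (p : R) : \bar R :=
  let law_I := exponential_prob (batch_rate p) in
  (\int[law_I]_(t in `[0%R, +oo[) (T t)%:E /
   (\int[law_I]_(t in `[0%R, +oo[) t%:E +
    (rho / (batch_rate p * (1 - rho)))%:E))%E.

Definition policy_throughput (T : R -> R) (r : R -> R -> R) : \bar R :=
  throughput T (mean r).

(* The threshold is an extended real because p = 0 forces it to be +oo. *)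
Definition threshold_policy (tau : \bar R) (x1 x2 : R) : R :=
  ((tau < (game_weight x1 x2)%:E)%E)%:R.

Definition is_threshold_at (tau : \bar R) (p : R) : Prop :=
  P [set w | (tau < (game_weight (X1 w) (X2 w))%:E)%E] = p%:E.

Definition det_split_prob (oA oB : R -> bool) : R :=
  mean (fun x1 x2 => (splits R (oA x1) (oB x2))%:R).

Definition det_payoff (oA oB : R -> bool) : R :=
  - mean (fun x1 x2 =>
      outcome R (oA x1) * outcome R (oB x2) * game_weight x1 x2).

Definition sr_split_prob (s : sr_strategy R) : R :=
  \int[sr_law s]_k det_split_prob (sr_oA s k) (sr_oB s k).

Definition sr_payoff (s : sr_strategy R) : R :=
  \int[sr_law s]_k det_payoff (sr_oA s k) (sr_oB s k).

Definition qs_split_prob (q : quantum_strategy R) : R := mean (qs_splitting q).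

Definition qs_payoff (q : quantum_strategy R) : R :=
  - mean (fun x1 x2 => qs_correlation q x1 x2 * game_weight x1 x2).

Definition optimal_sr_payoff (p : R) : \bar R :=
  ereal_sup [set a | exists s : sr_strategy R,
    sr_split_prob s = p /\ a = (sr_payoff s)%:E].

Definition wait_gap (tau : \bar R) (r : R -> R -> R) : R :=
  mean_wait r - mean_wait (threshold_policy tau).

Definition optimal_sr_wait_gap (tau : \bar R) (p : R) : \bar R :=
  ereal_inf [set g | exists s : sr_strategy R,
    sr_split_prob s = p /\ g = (wait_gap tau (sr_splitting s))%:E].

Definition quantum_advantage_set (qs : R -> quantum_strategy R) : set R :=
  [set p | (0 <= p <= 1) /\ (optimal_sr_payoff p < (qs_payoff (qs p))%:E)%E].

End Queue.

(* Main.v *)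
(* The mean wait of a policy with splitting probability r is an affine function
   of E[r w], and so is its game payoff, since o_A o_B = 1 - 2 [split] turns
   -E[o_A o_B w] into 2 E[r w] - E[w].  Hence the wait gap equals a constant
   minus half the payoff, for classical and quantum strategies alike, and the
   infimum of the gaps is governed by the supremum of the payoffs.  The
   throughput depends on the policy only through its splitting probability.

   Measurability of the Born probabilities needs no separability: the shared
   state is approximated by finite sums of product vectors, on which the joint
   effects give finite sums of products of local matrix elements, and joint
   effects are contractions, so the approximation passes to the limit. *)
From HB Require Import structures.
Require Import Defs.
From mathcomp Require Import all_boot all_order all_algebra.
From mathcomp Require Import complex.
From mathcomp Require Import all_classical all_reals all_analysis.
From mathcomp Require Import measurable_realfun ring lra.

Import Order.TTheory GRing.Theory Num.Theory.
Import numFieldNormedType.Exports.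
Local Open Scope classical_set_scope.
Local Open Scope ring_scope.

(** * Integration against a measure given by a density *)

Section Density.
Context {d : measure_display} {T : measurableType d} {R : realType}.
Variables (mu nu : {measure set T -> \bar R}) (g : T -> R).
Hypotheses (mg : measurable_fun setT g) (g0 : forall x, 0 <= g x).
Hypothesis nuE :
  forall A, measurable A -> nu A = (\int[mu]_(x in A) (g x)%:E)%E.

Let mgE : measurable_fun setT (EFin \o g).
Proof. exact/measurable_EFinP. Qed.

Let integral_density_indic A : measurable A ->
  (\int[nu]_x (\1_A x)%:E = \int[mu]_x ((\1_A x)%:E * (g x)%:E))%E.
Proof.
move=> mA; rewrite integral_indic//= setIT nuE// integral_mkcond.
apply: eq_integral => x _; rewrite patchE indicE.
by case: ifP; rewrite ?mul1e ?mul0e.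
Qed.

Import HBNNSimple.

Let integral_density_nnsfun (f : {nnsfun T >-> R}) :
  (\int[nu]_x (f x)%:E = \int[mu]_x ((f x)%:E * (g x)%:E))%E.
Proof.
under [LHS]eq_integral do rewrite fimfunE -fsumEFin//.
rewrite [LHS]ge0_integral_fsum//; last 2 first.
  - by move=> r; exact/measurable_EFinP/measurableT_comp.
  - by move=> n x _; rewrite EFinM nnfun_muleindic_ge0.
under [RHS]eq_integral.
  move=> x xD; rewrite fimfunE -fsumEFin// ge0_mule_fsuml; last first.
    by move=> r; rewrite EFinM nnfun_muleindic_ge0.
  over.
rewrite [RHS]ge0_integral_fsum//; last 2 first.
  - move=> r; apply: emeasurable_funM => //.
    exact/measurable_EFinP/measurableT_comp.
  - move=> n x _; apply: mule_ge0; last by rewrite lee_fin.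
    by rewrite EFinM nnfun_muleindic_ge0.
apply: eq_fsbigr => r _.
rewrite integralZl_indic_nnsfun//= integral_density_indic//.
(* Pulling the scalar out of the integral needs [0 <= r]. A negative [r] is not a value of the
   nonnegative [f], so its preimage is empty and both sides vanish. *)
have [r0|r0] := leP 0%R r.
  rewrite -ge0_integralZl//; last 2 first.
  - apply: emeasurable_funM => //; exact/measurable_EFinP/measurable_indic.
  - by move=> x _; rewrite mule_ge0// lee_fin.
  by apply: eq_integral => x _; rewrite EFinM muleA.
rewrite preimage_nnfun0// indic0 /=.
by rewrite !integral0_eq ?mule0// => x _; rewrite ?mulr0 mul0e.
Qed.

(** The identity climbs from indicators to simple functions to monotone limits; [g >= 0] keeps the
    approximations nondecreasing after multiplication by the density. *)
Lemma ge0_integral_density (f : T -> \bar R) :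
  measurable_fun setT f -> (forall x, 0 <= f x)%E ->
  (\int[nu]_x f x = \int[mu]_x (f x * (g x)%:E))%E.
Proof.
move=> mf f0.
pose f_ := nnsfun_approx measurableT mf.
transitivity (lim (\int[nu]_x (f_ n x)%:E @[n --> \oo])%E).
  rewrite -monotone_convergence//=.
  - apply: eq_integral => ? /[!inE] xD; apply/esym/cvg_lim => //=.
    exact: cvg_nnsfun_approx.
  - by move=> n; exact/measurable_EFinP/measurable_funTS.
  - by move=> n ? _; rewrite lee_fin.
  - by move=> ? _ ? ? mn; rewrite lee_fin; exact/lefP/nd_nnsfun_approx.
under eq_fun do rewrite integral_density_nnsfun.
rewrite -monotone_convergence//=.
- apply: eq_integral => x _; apply/cvg_lim => //.
  by apply: cvgeMr => //; exact: cvg_nnsfun_approx.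
- move=> n; apply: emeasurable_funM => //.
  exact/measurable_EFinP/measurable_funTS.
- by move=> n ? _; rewrite mule_ge0// lee_fin.
- move=> ? _ ? ? mn; apply: lee_wpmul2r; rewrite lee_fin//.
  exact/lefP/nd_nnsfun_approx.
Qed.
End Density.

(** * Finite second moment of the exponential law *)

Lemma sqr_le_expR (R : realType) (x : R) : 0 <= x -> x ^+ 2 <= 4 * expR x.
Proof.
move=> x0; have h : x / 2 <= expR (x / 2) by have := expR_ge1Dx (x / 2); lra.
have -> : expR x = expR (x / 2) ^+ 2 by rewrite -expRM_natl; congr expR; lra.
have : (x / 2) ^+ 2 <= expR (x / 2) ^+ 2 by rewrite lerXn2r ?nnegrE//; lra.
lra.
Qed.

(** Half of the exponent absorbs the quadratic factor, and the other half is an exponential density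
    of rate [mu / 2]. The constant 32 collects 4 from [sqr_le_expR], [4 / mu ^+ 2] from rescaling
    [x], and 2 from the ratio of the two rates. *)
Lemma sqr_exponential_pdf_le (R : realType) (mu x : R) : 0 < mu ->
  x ^+ 2 * exponential_pdf mu x <= 32 / mu ^+ 2 * exponential_pdf (mu / 2) x.
Proof.
move=> mu0; have [x0|x0] := ltP x 0.
  by rewrite !lt0_exponential_pdf// !mulr0.
rewrite !exponential_pdfE//.
have y0 : 0 <= mu / 2 * x by rewrite mulr_ge0// divr_ge0// ltW.
have -> : expR (- mu * x) = expR (- (mu / 2) * x) * expR (- (mu / 2 * x)).
  by rewrite -expRD; congr expR; lra.
rewrite expRN; set E := expR (- (mu / 2) * x).
have E0 : 0 < E by exact: expR_gt0.
have F0 := expR_gt0 (mu / 2 * x).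
have -> : x ^+ 2 * (mu * (E / expR (mu / 2 * x))) =
  (mu / 2 * x) ^+ 2 / expR (mu / 2 * x) * (4 / mu * E).
  by field; rewrite !gt_eqF.
have -> : 32 / mu ^+ 2 * (mu / 2 * E) = 4 * (4 / mu * E).
  by field; rewrite gt_eqF.
rewrite ler_pM2r; last by rewrite mulr_gt0// divr_gt0.
by rewrite ler_pdivrMr// sqr_le_expR.
Qed.

(** The integrand is dominated by a multiple of the density of rate [mu / 2], whose total mass is
    1. *)
Lemma exponential_sqr_integral_lty (R : realType) (mu : R)
    (nu : {measure set (measurableTypeR R) -> \bar R}) : 0 < mu ->
  (forall A, measurable A -> nu A = exponential_prob mu A) ->
  (\int[nu]_x (x ^+ 2)%:E < +oo)%E.
Proof.
move=> mu0 nuE.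
have msq : measurable_fun [set: measurableTypeR R] (fun x : R => (x ^+ 2)%:E).
  exact/measurable_EFinP/measurable_funX.
have mpdf r : measurable_fun [set: measurableTypeR R]
    (EFin \o exponential_pdf (r : R)).
  by apply/measurable_EFinP; exact: measurable_exponential_pdf.
have pdf0 r x : 0 < r -> 0 <= exponential_pdf (r : R) x.
  by move=> r0; rewrite exponential_pdf_ge0// ltW.
have mu20 : 0 < mu / 2 by rewrite divr_gt0.
have C0 : 0 <= 32 / mu ^+ 2 by rewrite divr_ge0// sqr_ge0.
rewrite (ge0_integral_density lebesgue_measure nu (exponential_pdf mu))//;
  first last.
- by move=> x; rewrite lee_fin sqr_ge0.
- by move=> x; exact: pdf0.
- exact: measurable_exponential_pdf.
apply: (@le_lt_trans _ _ (32 / mu ^+ 2)%:E); last exact: ltry.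
rewrite -[leRHS]mule1 -(integral_exponential_pdf mu20).
rewrite -ge0_integralZl//; [|exact: mpdf|by move=> x _; rewrite lee_fin pdf0].
apply: ge0_le_integral => //.
- by move=> x _; rewrite -EFinM lee_fin mulr_ge0 ?sqr_ge0 ?pdf0.
- by apply: emeasurable_funM => //; exact: mpdf.
- by apply: emeasurable_funM => //; exact: mpdf.
- by move=> x _; rewrite -!EFinM lee_fin sqr_exponential_pdf_le.
Qed.

Lemma exponential_sqr_integrable d (T : measurableType d) (R : realType)
    (P : probability T R) (X : {RV P >-> R}) (mu : R) : 0 < mu ->
  (forall A, measurable A -> distribution P X A = exponential_prob mu A) ->
  P.-integrable setT (fun w => (X w ^+ 2)%:E).
Proof.
move=> mu0 PX.
have msq : measurable_fun [set: R] (fun x : R => (x ^+ 2)%:E).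
  exact/measurable_EFinP/measurable_funX.
apply/integrableP; split.
  by apply: (measurableT_comp msq); exact: measurable_funPT.
under eq_integral do rewrite gee0_abs ?lee_fin ?sqr_ge0//.
have mX : measurable_fun setT (X : T -> measurableTypeR R).
  by move=> mT B; exact: (measurable_funPT X mT (B : set R)).
(* [lebesgue_measure] lives on [measurableTypeR R], which has the same
   measurable sets as [R] but another display, so [X] is repackaged. *)
pose X' : {mfun T >-> measurableTypeR R} :=
  HB.pack (X : T -> measurableTypeR R) (isMeasurableFun.Build _ _ _ _ _ mX).
have msq' : measurable_fun [set: measurableTypeR R] (fun x : R => (x ^+ 2)%:E).
  exact: msq.
have sq0 (y : measurableTypeR R) : (0 <= (y ^+ 2)%:E)%E.
  by rewrite lee_fin sqr_ge0.
rewrite -(ge0_integral_distribution X' msq' sq0).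
apply: (exponential_sqr_integral_lty _ _ (distribution P X') mu0) => A.
exact: (PX A).
Qed.

(** * Real parts of complex numbers and the sign identity for outputs *)

Section ReComplex.
Context {R : realType}.
Implicit Types z t : R[i].

Lemma ReD z t : complex.Re (z + t) = complex.Re z + complex.Re t.
Proof. by case: z t => [? ?] [? ?]. Qed.

Lemma ReN z : complex.Re (- z) = - complex.Re z.
Proof. by case: z. Qed.

Lemma ReM z t : complex.Re (z * t) =
  complex.Re z * complex.Re t - complex.Im z * complex.Im t.
Proof. by case: z t => [? ?] [? ?]. Qed.

Lemma ReJ z : complex.Re (Num.conj z) = complex.Re z.
Proof. by case: z. Qed.

Lemma Re_ge0 z : 0 <= z -> 0 <= complex.Re z.
Proof. by rewrite lecE => /andP[]. Qed.
End ReComplex.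

Lemma outcomeM (R : realType) (a b : bool) :
  outcome R a * outcome R b = 1 - 2 * (splits R a b)%:R.
Proof.
have neq1 : (1 : R) != - 1 by rewrite gt_eqF//; lra.
by case: a b => -[]; rewrite /splits /outcome ?mulrNN ?mulr1 ?mul1r ?eqxx;
  rewrite ?(negbTE neq1) /=; lra.
Qed.

(** * The real inner product and quadratic forms of contractions *)

Section RealInner.
Context {R : realType}.

Definition reinner {H : hilbert R} (u v : H) : R := complex.Re (inner H u v).

Variable H : hilbert R.
Implicit Types u v w : H.

Lemma reinnerDl u v w : reinner (u + v) w = reinner u w + reinner v w.
Proof. by rewrite /reinner linearDl ReD. Qed.

Lemma reinnerDr u v w : reinner u (v + w) = reinner u v + reinner u w.
Proof. by rewrite /reinner linearDr ReD. Qed.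

Lemma reinnerNl u v : reinner (- u) v = - reinner u v.
Proof. by rewrite /reinner linearNl ReN. Qed.

Lemma reinnerNr u v : reinner u (- v) = - reinner u v.
Proof. by rewrite /reinner linearNr ReN. Qed.

Lemma reinnerC u v : reinner u v = reinner v u.
Proof. by rewrite /reinner hermC expr0 mul1r ReJ. Qed.

Lemma sqnorm_ge0 u : 0 <= sqnorm u.
Proof. exact/Re_ge0/dnorm_ge0. Qed.

Lemma sqnormE u : sqnorm u = reinner u u. Proof. by []. Qed.

Lemma reinnerZl (t : R) u v : reinner (t%:C%C *: u) v = t * reinner u v.
Proof. by rewrite /reinner linearZl_LR ReM/= mul0r subr0. Qed.

Lemma reinnerZr (t : R) u v : reinner u (t%:C%C *: v) = t * reinner u v.
Proof. by rewrite reinnerC reinnerZl reinnerC. Qed.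

Lemma reinner0l u : reinner 0 u = 0.
Proof. by rewrite /reinner linear0l. Qed.

Lemma reinner_suml I (s : seq I) (F : I -> H) u :
  reinner (\sum_(i <- s) F i) u = \sum_(i <- s) reinner (F i) u.
Proof.
exact: (big_morph (reinner^~ u) (fun v w => reinnerDl v w u) (reinner0l u)).
Qed.

Lemma reinner_sumr I (s : seq I) (F : I -> H) u :
  reinner u (\sum_(i <- s) F i) = \sum_(i <- s) reinner u (F i).
Proof.
by rewrite reinnerC reinner_suml; apply: eq_bigr => i _; rewrite reinnerC.
Qed.

(** Cauchy-Schwarz in its weighted, square-root-free form: it comes from the nonnegativity of the
    squared norms of [t u + v] and [- t u + v]. *)
Lemma reinner_le (t : R) u v : 0 < t ->
  `|reinner u v| <= (t * sqnorm u + t^-1 * sqnorm v) / 2.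
Proof.
move=> t0.
have quad (s : R) : 0 <= s ^+ 2 * sqnorm u + 2 * s * reinner u v + sqnorm v.
  have := sqnorm_ge0 (s%:C%C *: u + v).
  rewrite sqnormE reinnerDl !reinnerDr !reinnerZl !reinnerZr (reinnerC v u).
  rewrite -!sqnormE; lra.
have -> : (t * sqnorm u + t^-1 * sqnorm v) / 2 =
  (t ^+ 2 * sqnorm u + sqnorm v) / (2 * t).
  by field; rewrite gt_eqF.
rewrite ler_pdivlMr ?mulr_gt0//.
have := quad t; have := quad (- t); rewrite sqrrN => q1 q2.
by case: (ler0P (reinner u v)) => _; lra.
Qed.

Definition contraction (E : {linear H -> H}) :=
  forall u, sqnorm (E u) <= sqnorm u.

Lemma contraction_form_le E u : contraction E ->
  `|reinner (E u) u| <= sqnorm u.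
Proof.
move=> /(_ u) cE; apply: le_trans (reinner_le 1 _ _ _) _ => //.
rewrite invr1 !mul1r; lra.
Qed.

(** Quantitative continuity of the quadratic form, uniform in [E]. The cross terms are bounded by
    [reinner_le] with weights [t] and [t^-1]; a large [t] makes the [u] term small, at the price of
    a smaller [e]. *)
Lemma contraction_form_approx E u e (t : R) : contraction E -> 0 < t ->
  `|reinner (E (u - e)) (u - e) - reinner (E u) u| <=
  (t + 1) * sqnorm e + t^-1 * sqnorm u.
Proof.
move=> cE t0.
have -> : reinner (E (u - e)) (u - e) - reinner (E u) u =
  reinner (E e) e - reinner (E e) u - reinner (E u) e.
  rewrite linearB !reinnerDl !reinnerDr !reinnerNl !reinnerNr; lra.
have h1 := contraction_form_le E e cE.
have h2 := reinner_le t (E e) u t0.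
have tV0 : 0 < t^-1 by rewrite invr_gt0.
have h3 := reinner_le t^-1 (E u) e tV0; rewrite invrK in h3.
have h4 : t * sqnorm (E e) <= t * sqnorm e by rewrite ler_pM2l.
have h5 : t^-1 * sqnorm (E u) <= t^-1 * sqnorm u by rewrite ler_pM2l.
apply: le_trans (ler_normB _ _) _.
apply: le_trans (lerD (ler_normB _ _) (lexx _)) _.
lra.
Qed.

End RealInner.
Arguments contraction {R H} E.

(** * Approximation by finite sums of product vectors *)

Section Tensor.
Context {R : realType} {HA HB : hilbert R} (H : hilbert_tensor HA HB).

Definition tens_sum (s : seq (HA * HB)) : H :=
  \sum_(ab <- s) tens H ab.1 ab.2.

(** The order of quantifiers matters: one sequence serves all contractions, hence the joint effects
    for all inputs at once. *)
Lemma tens_dense (psi : H) : exists phi : nat -> seq (HA * HB),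
  forall E : {linear H -> H}, contraction E ->
    reinner (E (tens_sum (phi n))) (tens_sum (phi n)) @[n --> \oo] -->
    reinner (E psi) psi.
Proof.
(* The tolerance matches [contraction_form_approx] at [t = n.+1]: there the error is multiplied by
   [n.+2], which leaves at most [n.+1^-1]. *)
have /choice[phi phiP] (n : nat) : exists s : seq (HA * HB),
    sqnorm (psi - tens_sum s) < (n.+1%:R * n.+2%:R)^-1.
  by apply: (tens_total (h := H)); rewrite invr_gt0 mulr_gt0.
exists phi => E cE.
have bound n : `|reinner (E (tens_sum (phi n))) (tens_sum (phi n)) -
    reinner (E psi) psi| <= (1 + sqnorm psi) * harmonic n.
  have := contraction_form_approx _ E psi (psi - tens_sum (phi n)) n.+1%:R cE.
  rewrite subKr => /(_ _)/le_trans; apply; first by rewrite ltr0n.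
  have -> : (1 + sqnorm psi) * harmonic n =
    n.+1%:R^-1 + n.+1%:R^-1 * sqnorm psi by rewrite /=; ring.
  rewrite lerD2r natr1 mulrC -ler_pdivlMr ?ltr0n// -invfM.
  exact: ltW.
apply/subr_cvg0/norm_cvg0P.
apply: (@squeeze_cvgr _ _ _ _ (cst 0) _ _ _ _ (@cvg_cst _ _ _ _ _)).
  by apply: nearW => n; rewrite normr_ge0; exact: bound.
rewrite -[X in _ --> X](mulr0 (1 + sqnorm psi)).
by apply: cvgMl_tmp; exact: cvg_harmonic.
Qed.

Lemma tensor_operator_contraction P Q (E : {linear H -> H}) :
  is_tensor_operator P Q E -> contraction E.
Proof. by case. Qed.

(** Separates the two inputs: each summand is the real part of a product of one local matrix element
    of [P] and one of [Q]. *)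
Lemma tensor_operator_form P Q (E : {linear H -> H}) s :
  is_tensor_operator P Q E ->
  reinner (E (tens_sum s)) (tens_sum s) =
  \sum_(x <- s) \sum_(y <- s)
    (reinner (P x.1) y.1 * reinner (Q x.2) y.2 -
     complex.Im (inner HA (P x.1) y.1) * complex.Im (inner HB (Q x.2) y.2)).
Proof.
move=> [EE _]; rewrite /tens_sum linear_sum reinner_suml.
apply: eq_bigr => x _; rewrite reinner_sumr.
by apply: eq_bigr => y _; rewrite EE /reinner inner_tens ReM.
Qed.
End Tensor.

(** * Born probabilities of a quantum strategy *)

Section QuantumStrategy.
Context {R : realType} (q : quantum_strategy R).

Lemma joint_contraction x1 x2 a b : contraction (qs_joint q x1 x2 a b).
Proof. exact: tensor_operator_contraction (qs_jointE q x1 x2 a b). Qed.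

(** On sums of product vectors the four joint effects add up to the identity, by bilinearity and
    [effect_sum]; density carries this over to [psi]. *)
Lemma joint_form_sum x1 x2 psi :
  \sum_(a : bool) \sum_(b : bool) reinner (qs_joint q x1 x2 a b psi) psi =
  sqnorm psi.
Proof.
have [phi phiP] := tens_dense _ psi.
have sumE (s : seq (qs_HA q * qs_HB q)) : \sum_(a : bool) \sum_(b : bool)
    reinner (qs_joint q x1 x2 a b (tens_sum _ s)) (tens_sum _ s) =
    reinner (tens_sum (qs_H q) s) (tens_sum _ s).
  rewrite !big_bool /= -!reinnerDl; congr reinner.
  rewrite /tens_sum !linear_sum -!big_split /=; apply: eq_bigr => x _.
  rewrite !(proj1 (qs_jointE q x1 x2 _ _)) -!linearDr -linearDl.
  by rewrite !effect_sum.
(* The identity is itself a contraction, so the squared norms converge along the same sequence. *)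
rewrite -[RHS](cvg_lim (@Rhausdorff R) (phiP idfun (fun u => lexx _))).
apply/esym/(cvg_lim (@Rhausdorff R)).
under eq_cvg do rewrite /= -sumE.
apply: cvg_big => [|a _]; first exact: add_continuous.
apply: cvg_big => [|b _]; first exact: add_continuous.
exact/phiP/joint_contraction.
Qed.

Section Prob.
Variables x1 x2 : R.

Let term a b k := qs_weight q k *
  reinner (qs_joint q x1 x2 a b (qs_vector q k)) (qs_vector q k).

Let term_le a b k : `|term a b k| <= qs_weight q k.
Proof.
rewrite /term normrM ger0_norm ?qs_weight_ge0// ler_piMr ?qs_weight_ge0//.
rewrite -(qs_vector_unit q k); apply: contraction_form_le.
exact: joint_contraction.
Qed.

Let normed_term_cvg a b : cvgn [normed series (term a b)].
Proof.
apply: (series_le_cvg _ (qs_weight_ge0 q) (term_le a b)) => [//|].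
exact: cvgP (qs_weight_sum q).
Qed.

(** [limn] is meaningful only for convergent series. Here convergence is absolute, by comparison
    with the weights, since a contraction has form at most 1 on a unit vector. *)
Lemma qs_prob_cvg a b :
  series (term a b) n @[n --> \oo] --> qs_prob q x1 x2 a b.
Proof. exact: normed_cvg. Qed.

Lemma qs_prob_le1 a b : `|qs_prob q x1 x2 a b| <= 1.
Proof.
apply: (le_trans (lim_series_norm (normed_term_cvg a b))).
rewrite -[leRHS](cvg_lim (@Rhausdorff R) (qs_weight_sum q)).
apply: (lim_series_le (normed_term_cvg a b) _ (term_le a b)).
exact: cvgP (qs_weight_sum q).
Qed.

Lemma qs_prob_sum : \sum_(a : bool) \sum_(b : bool) qs_prob q x1 x2 a b = 1.
Proof.
rewrite -[RHS](cvg_lim (@Rhausdorff R) (qs_weight_sum q)).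
apply/esym/(cvg_lim (@Rhausdorff R)).
have -> : series (qs_weight q) =
    fun n => \sum_(a : bool) \sum_(b : bool) series (term a b) n.
  apply/funext => n; rewrite /series/=.
  under [RHS]eq_bigr do rewrite exchange_big/=.
  rewrite [RHS]exchange_big/=; apply: eq_bigr => k _.
  under [RHS]eq_bigr do rewrite -mulr_sumr.
  by rewrite -mulr_sumr joint_form_sum qs_vector_unit mulr1.
apply: cvg_big => [|a _]; first exact: add_continuous.
apply: cvg_big => [|b _]; first exact: add_continuous.
exact: qs_prob_cvg.
Qed.

(** The 1 is expanded as the total probability, after which [outcomeM] gives the identity term by
    term. *)
Lemma qs_correlationE :
  qs_correlation q x1 x2 = 1 - 2 * qs_splitting q x1 x2.
Proof.
rewrite -[X in _ = X - _]qs_prob_sum mulr_sumr -sumrB.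
apply: eq_bigr => a _; rewrite [X in 2 * X]big_mkcond mulr_sumr -sumrB.
apply: eq_bigr => b _.
by rewrite outcomeM; case: splits => /=; ring.
Qed.

(** A crude count of four probabilities; it serves only to make products with integrable functions
    integrable. *)
Lemma qs_splitting_le4 : `|qs_splitting q x1 x2| <= 4.
Proof.
apply: le_trans (ler_norm_sum _ _ _) _.
apply: (@le_trans _ _ (\sum_(a : bool) 2)); last by rewrite big_bool/=; lra.
apply: ler_sum => a _; rewrite big_mkcond.
apply: le_trans (ler_norm_sum _ _ _) _.
apply: (@le_trans _ _ (\sum_(b : bool) 1)); last by rewrite big_bool/=; lra.
apply: ler_sum => b _; case: ifP => _; first exact: qs_prob_le1.
by rewrite normr0.
Qed.

End Prob.

(** Replacing [u] by [-i u] turns the imaginary part into a real part. *)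
Lemma measurable_effect_Im (H : hilbert R) (M : R -> measurement H)
    (o : bool) :
  (forall u v, measurable_fun [set: R]
     (fun x => complex.Re (inner H (effect (M x) o u) v))) ->
  forall u v, measurable_fun [set: R]
     (fun x => complex.Im (inner H (effect (M x) o u) v)).
Proof.
move=> mRe u v.
have := mRe (- ('i%C *: u)) v; congr measurable_fun; apply/funext => x.
rewrite linearN linearZ linearNl linearZl_LR /=.
by case: (inner H _ _) => r i /=; rewrite mul0r mul1r sub0r opprK.
Qed.

Lemma measurable_joint_form d (T : measurableType d) (X1 X2 : T -> R) a b psi :
  measurable_fun setT X1 -> measurable_fun setT X2 ->
  measurable_fun setT
    (fun w => reinner (qs_joint q (X1 w) (X2 w) a b psi) psi).
Proof.
move=> mX1 mX2; have [phi phiP] := tens_dense _ psi.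
apply: (@measurable_fun_cvg _ _ _ _ (fun n w =>
   reinner (qs_joint q (X1 w) (X2 w) a b (tens_sum _ (phi n)))
     (tens_sum _ (phi n)))); last first.
  by move=> w _; apply/phiP/joint_contraction.
move=> n.
under eq_fun do rewrite (tensor_operator_form _ _ _ _ _ (qs_jointE q _ _ a b)).
apply: measurable_sum => x; apply: measurable_sum => y.
have mA := @qs_MA_measurable R q a.
have mB := @qs_MB_measurable R q b.
apply: measurable_funB; apply: measurable_funM.
- exact: measurableT_comp (mA x.1 y.1) mX1.
- exact: measurableT_comp (mB x.2 y.2) mX2.
- exact: measurableT_comp (measurable_effect_Im _ _ _ mA x.1 y.1) mX1.
- exact: measurableT_comp (measurable_effect_Im _ _ _ mB x.2 y.2) mX2.
Qed.

Lemma measurable_qs_splitting d (T : measurableType d) (X1 X2 : T -> R) :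
  measurable_fun setT X1 -> measurable_fun setT X2 ->
  measurable_fun setT (fun w => qs_splitting q (X1 w) (X2 w)).
Proof.
move=> mX1 mX2; apply: measurable_sum => a.
under eq_fun do rewrite big_mkcond.
apply: measurable_sum => b; case: splits; last exact: measurable_cst.
apply: (@measurable_fun_cvg _ _ _ _ (fun n w => series (fun k =>
  qs_weight q k * reinner (qs_joint q (X1 w) (X2 w) a b (qs_vector q k))
    (qs_vector q k)) n)) => [n|w _]; last exact: qs_prob_cvg.
apply: measurable_sum => k; apply: measurable_funM; first exact: measurable_cst.
exact: measurable_joint_form.
Qed.

End QuantumStrategy.

(** * Fubini and averaging over shared randomness *)

Lemma Rintegral_fubini d1 d2 (T1 : measurableType d1) (T2 : measurableType d2)
    (R : realType) (m1 : {sigma_finite_measure set T1 -> \bar R})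
    (m2 : {sigma_finite_measure set T2 -> \bar R}) (f : T1 * T2 -> R) :
  (m1 \x m2)%E.-integrable setT (EFin \o f) ->
  (forall x, m2.-integrable setT (fun y => (f (x, y))%:E)) ->
  (forall y, m1.-integrable setT (fun x => (f (x, y))%:E)) ->
  m1.-integrable setT (fun x => (\int[m2]_y f (x, y))%:E) /\
  \int[m1]_x \int[m2]_y f (x, y) = \int[m2]_y \int[m1]_x f (x, y).
Proof.
(* Integrability of every section makes the inner integrals finite everywhere, so passing to real
   values loses nothing. *)
move=> imf if2 if1.
have FE : (fun x => (\int[m2]_y f (x, y))%:E) = fubini_F m2 (EFin \o f).
  apply/funext => x; rewrite /Rintegral fineK//.
  exact: integrable_fin_num (if2 x).
have GE : (fun y => (\int[m1]_x f (x, y))%:E) = fubini_G m1 (EFin \o f).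
  apply/funext => y; rewrite /Rintegral fineK//.
  exact: integrable_fin_num (if1 y).
split; first by rewrite FE; exact: integrable_fubini_F.
rewrite {1}/Rintegral FE [in RHS]/Rintegral GE.
by rewrite integral12_prod_meas1// integral21_prod_meas1.
Qed.

Lemma integral_probability_cst d (T : measurableType d) (R : realType)
    (Q : probability T R) (r : \bar R) : (\int[Q]_x r = r)%E.
Proof. by rewrite integral_cst// [X in (_ * X)%E]probability_setT mule1. Qed.

Section Strategies.
Context {R : realType} {d : measure_display} {Omega : measurableType d}.
Variables (P : probability Omega R).

Lemma integrable_bounded_mul (h g : Omega -> R) (M : R) :
  measurable_fun setT h -> (forall w, `|h w| <= M) ->
  P.-integrable setT (EFin \o g) ->
  P.-integrable setT (fun w => (h w * g w)%:E).
Proof.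
move=> mh hM ig.
apply: (@eq_integrable _ _ _ P setT _ ((EFin \o h) \* (EFin \o g))%E) => //.
apply: integrableMr => //.
exists M; split => [|x Mx w _]; first exact: num_real.
exact: le_trans (hM w) (ltW Mx).
Qed.

Section SharedRandomness.
Variables (X1 X2 : {RV P >-> R}) (s : sr_strategy R) (g : Omega -> R).
Hypothesis ig : P.-integrable setT (EFin \o g).

Let split_fun (z : sr_space s * Omega) : R :=
  (splits R (sr_oA s z.1 (X1 z.2)) (sr_oB s z.1 (X2 z.2)))%:R.

Let split_fun_le1 z : `|split_fun z| <= 1.
Proof. by rewrite /split_fun; case: splits; rewrite ?normr1 ?normr0. Qed.

Let measurable_output (X : {RV P >-> R}) (o : sr_space s -> R -> bool) :
  measurable_fun [set: sr_space s * R] (fun z => o z.1 z.2) ->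
  measurable_fun [set: sr_space s * Omega] (fun z => o z.1 (X z.2)).
Proof.
move=> mo; apply: (measurableT_comp mo (g := fun z => (z.1, X z.2))).
apply: measurable_fun_pair => //.
exact: measurableT_comp.
Qed.

Let measurable_split_fun : measurable_fun setT split_fun.
Proof.
(* As nested conditionals, the indicator depends on [z] only through the two measurable Boolean
   outputs. *)
have -> : split_fun = fun z =>
    if sr_oA s z.1 (X1 z.2)
    then if sr_oB s z.1 (X2 z.2) then 0 else 1
    else if sr_oB s z.1 (X2 z.2) then 1 else 0.
  apply/funext => z; have :=
    outcomeM R (sr_oA s z.1 (X1 z.2)) (sr_oB s z.1 (X2 z.2)).
  rewrite /split_fun /outcome.
  by case: sr_oA; case: sr_oB; rewrite ?mulrNN ?mulr1 ?mul1r; lra.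
apply: measurable_fun_ifT.
- by apply: measurable_output; exact: sr_oA_measurable.
- apply: measurable_fun_ifT => //.
  by apply: measurable_output; exact: sr_oB_measurable.
- apply: measurable_fun_ifT => //.
  by apply: measurable_output; exact: sr_oB_measurable.
Qed.

Lemma measurable_sr_splits k : measurable_fun setT (fun w =>
  (splits R (sr_oA s k (X1 w)) (sr_oB s k (X2 w)))%:R : R).
Proof. exact: measurableT_comp measurable_split_fun (measurable_pair1 k). Qed.

(** Dominated by [g], whose absolute integral over the product is the one under [P] because
    [sr_law s] has mass 1. *)
Let integrable_split_fun :
  (sr_law s \x P)%E.-integrable setT (fun z => (split_fun z * g z.2)%:E).
Proof.
have mg : measurable_fun setT g.
  by apply/measurable_EFinP; exact: measurable_int ig.
have mg2 : measurable_fun setT (fun z : sr_space s * Omega => (g z.2)%:E).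
  by apply/measurable_EFinP; exact: measurableT_comp.
apply: (@le_integrable _ _ _ (sr_law s \x P)%E setT _ _
  (fun z => (g z.2)%:E)) => //.
- apply/measurable_EFinP; apply: measurable_funM => //.
  exact/measurable_EFinP.
- by move=> z _; rewrite lee_fin normrM ler_piMl.
apply/integrable21ltyP => //.
rewrite (eq_integral (fun w => `|(g w)%:E|%E)); last first.
  move=> w _.
  exact: (integral_probability_cst _ _ _ (sr_law s) `|(g w)%:E|%E).
by case/integrableP : ig.
Qed.

Let integrable_split_fun1 w :
  (sr_law s).-integrable setT (fun k => (split_fun (k, w))%:E).
Proof.
apply: measurable_bounded_integrable => //.
- by apply: (le_lt_trans (probability_le1 (sr_law s) measurableT)); exact: ltry.
- exact: measurableT_comp (measurable_pair2 _).
- by exists 1; split => // x x1 k _; exact: le_trans (split_fun_le1 _) (ltW x1).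
Qed.

(** Trades the average over [kappa] of deterministic strategies for the single policy
    [sr_splitting s]. It is applied with [g = 1] for splitting probabilities and with the game
    weight for payoffs. *)
Lemma sr_fubini :
  (sr_law s).-integrable setT (fun k => (\int[P]_w (split_fun (k, w) * g w))%:E)
  /\ \int[sr_law s]_k (\int[P]_w (split_fun (k, w) * g w)) =
     \int[P]_w (sr_splitting s (X1 w) (X2 w) * g w).
Proof.
have [||ii ->] := @Rintegral_fubini _ _ _ _ _ (sr_law s) P
   (fun z => split_fun z * g z.2) integrable_split_fun.
- move=> k; apply: (@integrable_bounded_mul _ _ 1) => //.
  exact: measurableT_comp (measurable_pair1 _).
- move=> w.
  by have := integrableZr measurableT (g w) (integrable_split_fun1 w); exact.
split => //; apply: eq_Rintegral => w _.
by have := RintegralZr (g w) measurableT (integrable_split_fun1 w); exact.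
Qed.

Lemma measurable_sr_splitting :
  measurable_fun setT (fun w => sr_splitting s (X1 w) (X2 w)).
Proof.
apply: measurableT_comp; first exact: fine_measurable.
apply: (measurable_fun_fubini_tonelli_G (EFin \o split_fun)).
- exact/measurable_EFinP.
- by move=> z; rewrite lee_fin ler0n.
Qed.

Lemma sr_splitting_le1 w : `|sr_splitting s (X1 w) (X2 w)| <= 1.
Proof.
rewrite ger0_norm; last by apply: Rintegral_ge0 => k _; rewrite ler0n.
apply: (@le_trans _ _ (\int[sr_law s]_k 1)).
  apply: le_Rintegral => // [||k _].
  - exact: (integrable_split_fun1 w).
  - exact: finite_measure_integrable_cst.
  - by case: splits; rewrite ?ler01.
by rewrite Rintegral_cst// [X in fine X]probability_setT mulr1.
Qed.
End SharedRandomness.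

End Strategies.

(** * Mean waiting time as an affine function of the policy *)

Section Queueing.
Context {R : realType} {d : measure_display} {Omega : measurableType d}.
Variables (P : probability Omega R) (X1 X2 : {RV P >-> R}) (lambda mu : R).
Hypothesis mu_gt0 : 0 < mu.
Hypothesis X_iid : iid_exponential X1 X2 mu.

Let int (f : R -> R -> R) := P.-integrable setT (fun w => (f (X1 w) (X2 w))%:E).

Let intD f g : int f -> int g -> int (fun x y => f x y + g x y).
Proof. by move=> If Ig; have := integrableD measurableT If Ig; exact. Qed.

Let intZ k f : int f -> int (fun x y => k * f x y).
Proof. by move=> If; have := integrableZl measurableT k If; exact. Qed.

Let meanD f g : int f -> int g ->
  mean X1 X2 (fun x y => f x y + g x y) = mean X1 X2 f + mean X1 X2 g.
Proof. exact: RintegralD. Qed.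

Let meanZ k f : int f -> mean X1 X2 (fun x y => k * f x y) = k * mean X1 X2 f.
Proof. by move=> If; exact: RintegralZl. Qed.

Let int_sqr1 : int (fun x _ => x ^+ 2).
Proof. by case: X_iid => h _ _; exact: exponential_sqr_integrable h. Qed.

Let int_sqr2 : int (fun _ y => y ^+ 2).
Proof. by case: X_iid => _ h _; exact: exponential_sqr_integrable h. Qed.

(** Reduces integrability to the two second moments. The constant 2 makes room for linear terms, as
    the square of [x] plus 1 is at least twice the absolute value of [x]. *)
Let int_le (f : R -> R -> R) : measurable_fun setT (fun w => f (X1 w) (X2 w)) ->
  (forall x y, `|f x y| <= x ^+ 2 + y ^+ 2 + 2) -> int f.
Proof.
move=> mf fle.
have i2 : int (fun _ _ => 2) by exact: finite_measure_integrable_cst.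
apply: le_integrable (intD _ _ (intD _ _ int_sqr1 int_sqr2) i2) => //.
  exact/measurable_EFinP.
by move=> w _; rewrite lee_fin (le_trans (fle _ _))// ler_norm.
Qed.

Let mX1 : measurable_fun setT X1. Proof. exact: measurable_funPT. Qed.
Let mX2 : measurable_fun setT X2. Proof. exact: measurable_funPT. Qed.

Lemma integrable_prod : int (fun x y => x * y).
Proof.
apply: int_le => [|x y]; first exact: measurable_funM.
have := sqr_ge0 (x + y); have := sqr_ge0 (x - y).
by rewrite ler_norml => ? ?; apply/andP; split; lra.
Qed.

Lemma integrable_add : int (fun x y => x + y).
Proof.
apply: int_le => [|x y]; first exact: measurable_funD.
have := sqr_ge0 (x + 1); have := sqr_ge0 (x - 1).
have := sqr_ge0 (y + 1); have := sqr_ge0 (y - 1).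
by rewrite ler_norml => ? ? ? ?; apply/andP; split; lra.
Qed.

Lemma integrable_sqr_add : int (fun x y => (x + y) ^+ 2).
Proof.
rewrite (_ : (fun x y => _) = fun x y => x ^+ 2 + y ^+ 2 + 2 * (x * y)).
  exact: intD (intD _ _ int_sqr1 int_sqr2) (intZ _ _ integrable_prod).
by apply/funext => x; apply/funext => y; ring.
Qed.

Lemma integrable_game_weight : int (game_weight lambda mu).
Proof. exact: intD (intZ _ _ integrable_prod) (intZ _ _ integrable_add). Qed.

Section Policy.
Variables (r : R -> R -> R) (M : R).
Hypothesis mr : measurable_fun setT (fun w => r (X1 w) (X2 w)).
Hypothesis rM : forall w, `|r (X1 w) (X2 w)| <= M.

Let int_policy f : int f -> int (fun x y => r x y * f x y).
Proof. exact: integrable_bounded_mul rM. Qed.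

(** Splitting removes the cross term [2 x y] from the squared workload and [x + y] from the batch
    delay. With their coefficients these savings add up to exactly the game weight. *)
Lemma mean_waitE : mean_wait X1 X2 lambda mu r =
  lambda / 2 * mean X1 X2 (fun x y => (x + y) ^+ 2) / (2 * (1 - rho lambda mu))
  + 4^-1 * mean X1 X2 (fun x y => x + y)
  - mean X1 X2 (fun x y => r x y * game_weight lambda mu x y).
Proof.
rewrite /mean_wait /batch_rate_second_moment.
rewrite (_ : (fun x1 x2 => (1 - r x1 x2) * (x1 + x2) ^+ 2 + _) =
  fun x y => (x + y) ^+ 2 + (- 2) * (r x y * (x * y))); last first.
  by apply/funext => x; apply/funext => y; ring.
rewrite (_ : (fun x1 x2 => (1 - r x1 x2) * (x1 + x2)) =
  fun x y => (x + y) + (- 1) * (r x y * (x + y))); last first.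
  by apply/funext => x; apply/funext => y; ring.
rewrite (_ : (fun x y => r x y * game_weight lambda mu x y) =
  fun x y => lambda / (2 * (1 - rho lambda mu)) * (r x y * (x * y)) +
             4^-1 * (r x y * (x + y))); last first.
  by apply/funext => x; apply/funext => y; rewrite /game_weight; ring.
have ip := int_policy _ integrable_prod; have ia := int_policy _ integrable_add.
rewrite (meanD _ _ integrable_sqr_add (intZ _ _ ip)) (meanZ _ _ ip).
rewrite (meanD _ _ integrable_add (intZ _ _ ia)) (meanZ _ _ ia).
rewrite (meanD _ _ (intZ _ _ ip) (intZ _ _ ia)) (meanZ _ _ ip) (meanZ _ _ ia).
set D := 2 * (1 - _); set a := mean _ _ _.
have : 2 / 2 = 1 :> R by rewrite divff.
lra.
Qed.

Lemma mean_signed_weightE :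
  mean X1 X2 (fun x y => (1 - 2 * r x y) * game_weight lambda mu x y) =
  mean X1 X2 (game_weight lambda mu) -
  2 * mean X1 X2 (fun x y => r x y * game_weight lambda mu x y).
Proof.
have iw := integrable_game_weight; have irw := int_policy _ iw.
rewrite (_ : (fun x y => (1 - _) * _) = fun x y => game_weight lambda mu x y +
    (- 2) * (r x y * game_weight lambda mu x y)).
  by rewrite (meanD _ _ iw (intZ _ _ irw)) (meanZ _ _ irw) mulNr.
by apply/funext => x; apply/funext => y; ring.
Qed.

End Policy.
End Queueing.

(** * Payoffs against waiting times, and the strict comparison *)

Section Payoffs.
Context {R : realType} {d : measure_display} {Omega : measurableType d}.
Variables (P : probability Omega R) (X1 X2 : {RV P >-> R}) (lambda mu : R).
Hypothesis mu_gt0 : 0 < mu.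
Hypothesis X_iid : iid_exponential X1 X2 mu.

Let weighted_mean (r : R -> R -> R) :=
  mean X1 X2 (fun x y => r x y * game_weight lambda mu x y).
Let weight_mean := mean X1 X2 (game_weight lambda mu).

Let mX1 : measurable_fun setT X1. Proof. exact: measurable_funPT. Qed.
Let mX2 : measurable_fun setT X2. Proof. exact: measurable_funPT. Qed.

Lemma sr_split_probE (s : sr_strategy R) :
  sr_split_prob X1 X2 s = mean X1 X2 (sr_splitting s).
Proof.
have i1 : P.-integrable setT (EFin \o (fun _ : Omega => 1 : R)).
  exact: finite_measure_integrable_cst.
have [_] := sr_fubini P X1 X2 s _ i1.
rewrite /mean; under [X in _ = X]eq_Rintegral do rewrite mulr1.
move=> <-; apply: eq_Rintegral => k _; apply: eq_Rintegral => w _.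
by rewrite mulr1.
Qed.

Lemma sr_payoffE (s : sr_strategy R) :
  sr_payoff X1 X2 lambda mu s =
  2 * weighted_mean (sr_splitting s) - weight_mean.
Proof.
have iw := integrable_game_weight P X1 X2 lambda mu mu_gt0 X_iid.
have [ik E] := sr_fubini P X1 X2 s _ iw.
have detE k : det_payoff X1 X2 lambda mu (sr_oA s k) (sr_oB s k) =
    2 * mean X1 X2 (fun x y => (splits R (sr_oA s k x) (sr_oB s k y))%:R *
      game_weight lambda mu x y) - weight_mean.
  rewrite /det_payoff (_ : (fun x y => _) = fun x y =>
      (1 - 2 * (splits R (sr_oA s k x) (sr_oB s k y))%:R) *
      game_weight lambda mu x y); last first.
    by apply/funext => x; apply/funext => y; rewrite outcomeM.
  rewrite (mean_signed_weightE _ _ _ _ _ mu_gt0 X_iid _ 1).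
  - by rewrite opprB.
  - exact: measurable_sr_splits.
  - by move=> w; case: splits; rewrite ?normr1 ?normr0.
rewrite /sr_payoff; under eq_Rintegral do rewrite detE.
rewrite RintegralB//; last 2 first.
- by have := integrableZl measurableT 2 ik; exact.
- exact: finite_measure_integrable_cst.
rewrite (RintegralZl 2 measurableT ik) E Rintegral_cst//.
by rewrite [X in fine X]probability_setT mulr1.
Qed.

Lemma qs_payoffE (q : quantum_strategy R) :
  qs_payoff X1 X2 lambda mu q =
  2 * weighted_mean (qs_splitting q) - weight_mean.
Proof.
rewrite /qs_payoff.
rewrite (_ : (fun x y => _) = fun x y =>
    (1 - 2 * qs_splitting q x y) * game_weight lambda mu x y).
  rewrite (mean_signed_weightE _ _ _ _ _ mu_gt0 X_iid _ 4).
  - by rewrite opprB.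
  - exact: measurable_qs_splitting.
  - by move=> w; exact: qs_splitting_le4.
by apply/funext => x; apply/funext => y; rewrite qs_correlationE.
Qed.

(** The mean wait of the policy that splits every pair with probability one half, the case of zero
    payoff. *)
Let wait_const :=
  lambda / 2 * mean X1 X2 (fun x y => (x + y) ^+ 2) / (2 * (1 - rho lambda mu))
  + 4^-1 * mean X1 X2 (fun x y => x + y) - weight_mean / 2.

Lemma mean_wait_sr_payoff (s : sr_strategy R) :
  mean_wait X1 X2 lambda mu (sr_splitting s) =
  wait_const - sr_payoff X1 X2 lambda mu s / 2.
Proof.
rewrite (mean_waitE _ _ _ _ _ mu_gt0 X_iid _ 1).
- by rewrite sr_payoffE /wait_const -/(weighted_mean _); lra.
- exact: measurable_sr_splitting.
- exact: sr_splitting_le1.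
Qed.

Lemma mean_wait_qs_payoff (q : quantum_strategy R) :
  mean_wait X1 X2 lambda mu (qs_splitting q) =
  wait_const - qs_payoff X1 X2 lambda mu q / 2.
Proof.
rewrite (mean_waitE _ _ _ _ _ mu_gt0 X_iid _ 4).
- by rewrite qs_payoffE /wait_const -/(weighted_mean _); lra.
- exact: measurable_qs_splitting.
- by move=> w; exact: qs_splitting_le4.
Qed.

(** Strictness survives the infimum because the margin is uniform: every classical gap exceeds the
    quantum one by at least half the distance from the optimal classical payoff to the quantum
    payoff. *)
Lemma quantum_wait_gap_lt (q : quantum_strategy R) (tau : \bar R) (p : R) :
  (optimal_sr_payoff X1 X2 lambda mu p < (qs_payoff X1 X2 lambda mu q)%:E)%E ->
  ((wait_gap X1 X2 lambda mu tau (qs_splitting q))%:E <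
   optimal_sr_wait_gap X1 X2 lambda mu tau p)%E.
Proof.
move=> lt_q.
have [[s ps]|no_sr] :=
    pselect (exists s : sr_strategy R, sr_split_prob X1 X2 s = p); last first.
  (* With no classical strategy at [p] the infimum is over the empty set, hence [+oo]. *)
  rewrite /optimal_sr_wait_gap (_ : [set _ | _] = set0) ?ereal_inf0 ?ltry//.
  by apply/seteqP; split => // g [s [ps _]]; apply: no_sr; exists s.
have ge_s s' : sr_split_prob X1 X2 s' = p ->
    ((sr_payoff X1 X2 lambda mu s')%:E <=
     optimal_sr_payoff X1 X2 lambda mu p)%E.
  by move=> ps'; apply: ereal_sup_ubound; exists s'.
(* The supremum is finite: [+oo] contradicts the strict advantage, and [-oo] the existence of
   [s]. *)
case E : (optimal_sr_payoff X1 X2 lambda mu p) => [m| |]; last 2 first.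
- by move: lt_q; rewrite E.
- by have := ge_s s ps; rewrite E.
move: lt_q; rewrite E lte_fin => lt_q.
apply: (@lt_le_trans _ _ (wait_gap X1 X2 lambda mu tau (qs_splitting q) +
   (qs_payoff X1 X2 lambda mu q - m) / 2)%:E).
  by rewrite lte_fin; lra.
apply/ereal_infP => _ [s' [ps' ->]].
have := ge_s s' ps'; rewrite E !lee_fin /wait_gap.
by rewrite mean_wait_sr_payoff mean_wait_qs_payoff; lra.
Qed.
End Payoffs.

Theorem theorem2 (R : realType) (lambda mu : R)
    (lambda_gt0 : 0 < lambda) (mu_gt0 : 0 < mu) (rho_lt1 : rho lambda mu < 1)
    (d : measure_display) (Omega : measurableType d) (P : probability Omega R)
    (X1 X2 : {RV P >-> R}) (X_iid : iid_exponential X1 X2 mu)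
    (T : R -> R) (T_diff : differentiable_halfline T)
    (T_incr : increasing_halfline T) (T0 : T 0 = 0)
    (T_convex : strictly_convex_halfline T)
    (tau : R -> \bar R)
    (tauP : forall p : R, 0 <= p <= 1 ->
       is_threshold_at X1 X2 lambda mu (tau p) p)
    (qs : R -> quantum_strategy R)
    (qsP : forall p : R, 0 <= p <= 1 -> qs_split_prob X1 X2 (qs p) = p) :
  forall p : R, quantum_advantage_set X1 X2 lambda mu qs p ->
    [/\ ((wait_gap X1 X2 lambda mu (tau p) (qs_splitting (qs p)))%:E <
         optimal_sr_wait_gap X1 X2 lambda mu (tau p) p)%E,
        policy_throughput X1 X2 lambda mu T (qs_splitting (qs p)) =
          throughput lambda mu T p
      & forall s : sr_strategy R, sr_split_prob X1 X2 s = p ->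
          policy_throughput X1 X2 lambda mu T (sr_splitting s) =
            throughput lambda mu T p].
Proof.
move=> p [p01 advantage]; split.
- exact: quantum_wait_gap_lt.
- by rewrite /policy_throughput -/(qs_split_prob _ _ _) qsP.
(* The throughput is taken at the mean of the averaged policy, which equals the average of the
   deterministic splitting probabilities. *)
- by move=> s <-; rewrite /policy_throughput sr_split_probE.
Qed.
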